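(* Let $q$ be a prime power and let $n$ be a positive integer coprime to $q$, written $n=2^mn'$ with $n'$ odd and $m\ge 0$. Let $r$ be the positive integer such that $2^r\,\|\,(q+1)$. Then $$|\Omega_{q^2,n}|=\begin{cases}2^m|\Omega_{q^2,n'}| & \text{if } 0\le m\le r,\\ 2^r|\Omega_{q^2,n'}| & \text{if } m>r.\end{cases}$$ In particular, $|\Omega_{q^2,1}|=1$ and $|\Omega_{q^2,2^m}|=2^m$ if $0\le m\le r$ and $|\Omega_{q^2,2^m}|=2^r$ if $m>r$.
   Context: $\mathbb{F}_{q^2}$ is the finite field with $q^2$ elements. For $\alpha\in\mathbb{F}_{q^2}$ put $\bar\alpha=\alpha^q$, and for $f(x)=\sum_i f_ix^i$ put $\overline{f(x)}=\sum_i \bar f_i x^i$. For $f(x)$ with $f(0)\neq 0$, $f^*(x)=x^{\deg f}f(0)^{-1}f(1/x)$ and $f^\dagger(x)=\overline{f^*(x)}$. A polynomial is SCRIM if it is monic, irreducible over $\mathbb{F}_{q^2}$, has nonzero constant term, and satisfies $f=f^\dagger$. $\Omega_{q^2,n}$ denotes the set of SCRIM polynomials in $\mathbb{F}_{q^2}[x]$ dividing $x^n-1$. For integers $s\ge 0$ and $i\ge1$, $2^s\|i$ means $2^s\mid i$ and $2^{s+1}\nmid i$. *)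

(* Defs.v *)
From HB Require Import structures.
From mathcomp Require Import all_boot all_order all_algebra.
From mathcomp Require Import boolp.
Set Implicit Arguments. Unset Strict Implicit. Unset Printing Implicit Defensive.
Import GRing.Theory.
Local Open Scope ring_scope.

Section SCRIM.
Variables (F : finFieldType) (q : nat).

Definition fconj (a : F) : F := a ^+ q.

Definition pconj (f : {poly F}) : {poly F} := map_poly fconj f.

(* f^*(x) = x^(deg f) f(0)^(-1) f(1/x) ; deg f = (size f).-1 *)
Definition precip (f : {poly F}) : {poly F} :=
  (f`_0)^-1 *: \poly_(i < size f) f`_((size f).-1 - i).

Definition pdagger (f : {poly F}) : {poly F} := pconj (precip f).

Definition SCRIM (f : {poly F}) : Prop :=
  [/\ f \is monic, irreducible_poly f, f`_0 != 0 & f = pdagger f].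

(* |Omega_{q^2,n}| : number of SCRIM polynomials dividing x^n - 1.
   For n > 0 every divisor of x^n - 1 has size <= n+1, so enumerating
   {poly_(n.+1) F} covers all of them. *)
Definition Omega_card (n : nat) : nat :=
  #|[set p : {poly_(n.+1) F} | `[< SCRIM (val p) >] && (val p %| 'X^n - 1)]|.

End SCRIM.

(* Main.v *)
(* The roots of a SCRIM polynomial p dividing x^n - 1 are permuted by
   x |-> x^(-q), and they are the conjugates x^(q^(2j)) of one root x; hence
   x^(q^e + 1) = 1 for some odd e.  As q + 1 and q^e + 1 have the same 2-adic
   valuation r (when q is odd), the 2-part z of x is a root of unity of order
   dividing 2^min(m,r), which divides q + 1, so z lies in F.  Dividing all the
   roots of p by z preserves being SCRIM, because z^(-q) = z.  Thus
   (z, p) |-> z^(deg p) p(x / z) is a bijection from the 2^min(m,r)-th roots of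
   unity times Omega_{n'} onto Omega_n. *)
Require Import Defs.
From mathcomp Require Import all_boot all_order all_algebra.
From mathcomp Require Import all_fingroup all_solvable all_field.
From mathcomp Require Import boolp zify.

Set Implicit Arguments. Unset Strict Implicit. Unset Printing Implicit Defensive.
Import GRing.Theory.
Local Open Scope ring_scope.

(** * Arithmetic of [q ^ e + 1] at the prime 2, and roots of unity *)

Lemma expn_odd_add1 q e : odd q -> odd e ->
  exists2 s, odd s & (q ^ e).+1 = (q.+1 * s)%N.
Proof.
move=> q_odd e_odd; rewrite -(odd_double_half e) e_odd add1n.
elim: e./2 => [|t [s s_odd IHt]]; first by exists 1%N; rewrite // muln1 expn1.
(* Raising the exponent by 2 adds (q^2 - 1) q^(2t+1), so the cofactor of q + 1 grows by (q - 1)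
   q^(2t+1), which is even because q is odd. *)
exists (s + q.-1 * q ^ t.*2.+1)%N.
  by rewrite oddD s_odd oddM; case: (q) q_odd => //= k /negPf->.
rewrite doubleS expnS [(q ^ _.+2)%N]expnS mulnDr -IHt.
move: (q ^ t.*2.+1)%N => x; case: (q) q_odd => // k _ /=; lia.
Qed.

(** Bounds the order of the 2-part of a root, which divides both 2^m and q^e + 1. The odd cofactor
    of q + 1 in q^e + 1 contributes no power of 2. *)
Lemma dvdn_gcdn_expn2 q m r e : odd e -> ~~ (2 ^ r.+1 %| q.+1)%N ->
  (gcdn (2 ^ m) (q ^ e).+1 %| 2 ^ minn m r)%N.
Proof.
move=> e_odd not_dvd.
have /(dvdn_pfactor _ _ (isT : prime 2))[k le_km gcdE] := dvdn_gcdl (2 ^ m) (q ^ e).+1.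
have dvd_k : (2 ^ k %| (q ^ e).+1)%N by rewrite -gcdE dvdn_gcdr.
rewrite gcdE dvdn_exp2l // leq_min le_km leqNgt; apply: contra not_dvd => lt_rk.
(* Here k > r >= 0, so q^e + 1 is even; an even q is excluded because e > 0. *)
have q_odd : odd q.
  have: (2 %| (q ^ e).+1)%N by apply: dvdn_trans dvd_k; rewrite dvdn_exp //; lia.
  by rewrite dvdn2 /= oddX negbK; case: (e) e_odd.
have [s s_odd qeE] := expn_odd_add1 q_odd e_odd.
apply: (@dvdn_trans (2 ^ k)); first exact: dvdn_exp2l.
by move: dvd_k; rewrite qeE Gauss_dvdl // coprimeXl // coprime2n.
Qed.

Lemma expr_gcdn_eq1 (R : unitRingType) (x : R) a b : (0 < a)%N ->
  x ^+ a = 1 -> x ^+ b = 1 -> x ^+ gcdn a b = 1.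
Proof.
move=> a_gt0 xa xb; case: (egcdnP b a_gt0) => u v uvE _.
have: x ^+ (u * a) = 1 by rewrite mulnC exprM xa expr1n.
by rewrite uvE exprD mulnC exprM xb expr1n mul1r.
Qed.


(** The multiplicative group of F is cyclic, so some [z] is a primitive N-th root of unity; its
    powers z^i with i < N are distinct and are all the solutions. *)
Lemma card_unity_roots (F : finFieldType) N : (0 < N)%N -> (N %| #|F|.-1)%N ->
  #|[set z : F | z ^+ N == 1]| = N.
Proof.
move=> N_gt0 dvdN; have F_gt1 := finNzRing_gt1 F.
have /hasP[w _ w_prim] : has (#|F|.-1).-primitive_root (enum (predC1 (0 : F))).
  apply: has_prim_root; first by rewrite -ltnS prednK // ltnW.
  - apply/allP=> x; rewrite mem_enum inE => x0; apply/unity_rootP.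
    by apply: (mulfI x0); rewrite -exprS prednK ?expf_card ?mulr1 // ltnW.
  - exact: enum_uniq.
  - by rewrite -cardE cardC1.
have {w_prim} z_prim := dvdn_prim_root w_prim dvdN; set z := w ^+ _ in z_prim.
rewrite -[RHS]card_ord -[RHS](@card_imset _ _ (fun i : 'I_N => z ^+ i)); last first.
  move=> i j /eqP; rewrite (eq_prim_root_expr z_prim) !modn_small //.
  by move/eqP/val_inj.
apply: eq_card => x; rewrite inE; apply/eqP/imsetP=> [/(prim_rootP z_prim)[i ->]|[i _ ->]].
  by exists i.
by rewrite exprAC (prim_expr_order z_prim) expr1n.
Qed.

(** * Scaling the roots of a polynomial *)

Section Twist.
Variable F : fieldType.
Implicit Types (z : F) (p g : {poly F}).

(* The polynomial [z ^ deg p * p (x / z)], whose roots are those of [p]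
   multiplied by [z]. *)
Definition twist z p : {poly F} :=
  \poly_(i < size p) (z ^+ ((size p).-1 - i) * p`_i).

Lemma coef_twist z p i : (twist z p)`_i = z ^+ ((size p).-1 - i) * p`_i.
Proof.
by rewrite coef_poly; case: ltnP => // le_pi; rewrite nth_default ?mulr0.
Qed.

Lemma size_twist z p : z != 0 -> size (twist z p) = size p.
Proof.
move=> z0; have [->|p0] := eqVneq p 0.
  by rewrite /twist size_poly0 poly_def big_ord0 size_poly0.
by rewrite size_poly_eq // subnn mul1r -lead_coefE lead_coef_eq0.
Qed.

Lemma twistM z z' p : z' != 0 -> twist (z * z') p = twist z (twist z' p).
Proof.
by move=> z'0; apply/polyP=> i; rewrite !coef_twist size_twist // exprMn mulrA.
Qed.

Lemma twist1 p : twist 1 p = p.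
Proof. by apply/polyP=> i; rewrite coef_twist expr1n mul1r. Qed.

Lemma twistK z : z != 0 -> cancel (twist z) (twist z^-1).
Proof. by move=> z0 p; rewrite -twistM // mulVf // twist1. Qed.

Lemma twistVK z : z != 0 -> cancel (twist z^-1) (twist z).
Proof. by move=> z0 p; rewrite -twistM ?invr_eq0 // mulfV // twist1. Qed.

(** The substitution form through which divisibility and roots are transported. *)
Lemma twistE z p : z != 0 ->
  twist z p = z ^+ (size p).-1 *: (p \Po (z^-1 *: 'X)).
Proof.
move=> z0; apply/polyP=> i; rewrite coef_twist coefZ coef_comp_poly.
under eq_bigr do rewrite exprZn coefZ coefXn.
have [lt_i|le_i] := ltnP i (size p); last first.
  rewrite nth_default // mulr0 big1 ?mulr0 // => j _.
  by rewrite gtn_eqF ?mulr0 // (leq_trans (ltn_ord j)).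
rewrite (bigD1 (Ordinal lt_i)) //= eqxx mulr1 big1 ?addr0 => [|j]; last first.
  by rewrite -val_eqE /= eq_sym => /negPf->; rewrite !mulr0.
by rewrite mulrCA mulrC exprVn -expfB_cond // (negPf z0) add0n; case: (size p) lt_i.
Qed.

Lemma twist_dvdp z p g : z != 0 -> p %| g -> twist z p %| twist z g.
Proof.
move=> z0 dvd_pg; rewrite !twistE //.
by rewrite dvdpZl ?dvdpZr ?expf_neq0 // dvdp_comp_poly.
Qed.

Lemma irreducible_twist z p :
  z != 0 -> irreducible_poly p -> irreducible_poly (twist z p).
Proof.
move=> z0 [p_gt1 irr_p]; split=> [|g g_neq1 dvd_g]; first by rewrite size_twist.
have zV0 : z^-1 != 0 by rewrite invr_eq0.
have /andP[_ dvd_p] : twist z^-1 g %= p.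
  apply: irr_p; first by rewrite size_twist.
  by rewrite -[p](twistK z0) twist_dvdp.
by rewrite /eqp dvd_g -[g](twistVK z0) twist_dvdp.
Qed.

Lemma monic_twist z p : z != 0 -> p \is monic -> twist z p \is monic.
Proof.
move=> z0; rewrite !monicE !lead_coefE size_twist // coef_twist subnn.
by rewrite mul1r.
Qed.

Lemma root_map_twist (L : fieldType) (f : {rmorphism F -> L}) z p x :
  z != 0 -> root (map_poly f (twist z p)) (f z * x) = root (map_poly f p) x.
Proof.
move=> z0; have fz0 : f z != 0 by rewrite fmorph_eq0.
rewrite twistE // map_polyZ map_comp_poly rootZ ?fmorph_eq0 ?expf_neq0 //.
rewrite /root horner_comp map_polyZ map_polyX hornerZ hornerX fmorphV.
by rewrite mulKf.
Qed.

End Twist.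

(** With d the degree of p, passing to the dagger turns the scaling factor of coefficient i into
    (z^-d z^i)^q = (z^-q)^(d-i); since z^-q = z, this is again z^(d-i). *)
Lemma SCRIM_twist (F : finFieldType) q (z : F) p :
  (0 < q)%N -> z ^+ q.+1 = 1 -> SCRIM q p -> SCRIM q (twist z p).
Proof.
move=> q_gt0 zq [p_monic p_irr p00 p_dag].
have z0 : z != 0 by apply: contra_eq_neq zq => ->; rewrite exprS mul0r eq_sym oner_eq0.
(* [fconj] is not declared as a morphism, so the coefficients of [pconj] are computed from [fconj]
   fixing 0, where q > 0 matters. *)
have fconj0 : fconj q 0 = 0 :> F by rewrite /fconj expr0n gtn_eqF.
have zVq : z ^- q = z by apply: (mulIf (expf_neq0 q z0)); rewrite mulVf ?expf_neq0 // -exprS.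
split; [exact: monic_twist | exact: irreducible_twist | |].
  by rewrite coef_twist mulf_neq0 ?expf_neq0.
apply/polyP=> i.
rewrite /pdagger /pconj coef_map_id0 // /precip coefZ coef_poly size_twist //.
rewrite !coef_twist.
have [lt_i|le_i] := ltnP i (size p); last first.
  by rewrite nth_default // !mulr0 fconj0.
have := congr1 (fun r : {poly F} => r`_i) p_dag.
rewrite /pdagger /pconj coef_map_id0 // /precip coefZ coef_poly lt_i => ->.
rewrite /fconj subn0 subKn; last by case: (size p) lt_i.
set d := (size p).-1; have le_id : (i <= d)%N by rewrite /d; case: (size p) lt_i.
rewrite invfM mulrACA exprMn [in RHS]exprMn; congr (_ * _); last by rewrite exprMn.
have -> : (z ^+ d)^-1 * z ^+ i = z^-1 ^+ (d - i).
  by rewrite exprVn -[in LHS](subnK le_id) exprD invfM divfK ?expf_neq0.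
by rewrite exprAC exprVn zVq.
Qed.

(** * Frobenius powers and roots of irreducible polynomials *)

Lemma expr_pchar_eq1 (R : idomainType) n (x : R) :
  [pchar R].-nat n -> x ^+ n = 1 -> x = 1.
Proof.
(* Additivity of the n-th power gives x^n = (x - 1)^n + 1. *)
move=> pn; rewrite -[in X in X = _](subrK 1 x) exprDn_pchar // expr1n.
rewrite -[X in _ = X]add0r => /addIr/eqP.
by rewrite expf_eq0 subr_eq0 => /andP[_ /eqP].
Qed.

Lemma expr_pchar_sum (R : comNzRingType) n (I : finType) (E : I -> R) :
  [pchar R].-nat n -> (\sum_i E i) ^+ n = \sum_i E i ^+ n.
Proof.
move=> pn; apply: (big_morph (fun x : R => x ^+ n)) => [x y|].
  exact: exprDn_pchar.
by case: n pn => // n _; rewrite exprS mul0r.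
Qed.

(** The gcd of p and g has the root x, so it is not constant and must be associate to p. *)
Lemma irreducible_dvdp_root (F L : fieldType) (f : {rmorphism F -> L})
    (p g : {poly F}) x :
  irreducible_poly p -> root (map_poly f p) x -> root (map_poly f g) x -> p %| g.
Proof.
move=> [_ irr_p] px gx.
have gcd_root : root (map_poly f (gcdp p g)) x by rewrite gcdp_map root_gcd px.
have: gcdp p g %= p.
  apply: irr_p (dvdp_gcdl _ _); apply/negP => /size_poly1P[c c0 gcdE].
  by move: gcd_root; rewrite gcdE map_polyC rootC fmorph_eq0 (negPf c0).
by move/eqp_dvdl <-; exact: dvdp_gcdr.
Qed.

(** Both x and y are roots of the minimal polynomial of x, hence Galois conjugate, and the Galois
    group is generated by a -> a^|F|. *)
Lemma irreducible_roots_Frobenius (F : finFieldType) (L : fieldExtType F)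
    (p : {poly F}) (x y : L) :
    irreducible_poly p ->
    root (map_poly (in_alg L) p) x -> root (map_poly (in_alg L) p) y ->
  exists j, y = x ^+ (#|F| ^ j).
Proof.
(* An extension of a finite field is a splitting field; equipping [L] with that structure gives
   access to Galois theory. *)
move: x y; wlog [{}L -> x y]: L / exists galL : splittingFieldType F, L = galL.
  by pose galL := FinSplittingFieldType F L => /(_ galL); apply; exists galL.
move=> irr_p px py.
have [alpha gen_alpha alphaE] := finField_galois_generator (sub1v {:L}%AS).
have /polyOver1P[g gE] := minPolyOver 1%AS x.
have min_y : root (minPoly 1%AS x) y.
  have dvd_pg : p %| g.
    by apply: irreducible_dvdp_root irr_p px _; rewrite -gE root_minPoly.
  by rewrite gE; apply: root_dvdp py; rewrite dvdp_map.
have nE : normalField 1%AS {:L}%AS.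
  by have /and3P[] := finField_galois (sub1v {:L}%AS).
have [s s_gal <-] := normalField_root_minPoly (sub1v _) nE (memvf x) min_y.
move: s_gal; rewrite (eqP gen_alpha) => /cycleP[j ->]; exists j.
elim: j => [|j IHj]; first by rewrite expg0 gal_id expr1.
by rewrite expgSr galM ?memvf // IHj alphaE ?memvf // dimv1 expn1 -exprM expnSr.
Qed.

Lemma irreducible_root_ext (F : fieldType) (p : {poly F}) : irreducible_poly p ->
  exists L : fieldExtType F, exists x : L, root (map_poly (in_alg L) p) x.
Proof. by case/irredp_FAdjoin => L _ [x px _]; exists L, x. Qed.

(** * Roots of SCRIM polynomials *)

Section Counting.
Variables (F : finFieldType) (q : nat).
Hypotheses (cardF : #|F| = (q ^ 2)%N) (q_pchar : [pchar F].-nat q).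
Implicit Types (p : {poly F}) (z : F).

Let q_gt0 : (0 < q)%N. Proof. by case/andP: q_pchar. Qed.

Lemma root_Xn_sub1 (L : fieldExtType F) p (x : L) n :
  irreducible_poly p -> root (map_poly (in_alg L) p) x ->
  (p %| 'X^n - 1) = (x ^+ n == 1).
Proof.
move=> irr_p px; have rootE : root (map_poly (in_alg L) ('X^n - 1)) x = (x ^+ n == 1).
  by rewrite rmorphB /= map_polyXn rmorph1 /root !hornerE subr_eq0.
rewrite -rootE; apply/idP/idP => [dvd_p|]; last exact: irreducible_dvdp_root.
by apply: root_dvdp px; rewrite dvdp_map.
Qed.

Lemma map_root_neq0 (L : fieldType) (f : {rmorphism F -> L}) p (x : L) :
  p`_0 != 0 -> root (map_poly f p) x -> x != 0.
Proof.
move=> p00; apply: contraTneq => ->.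
by rewrite /root horner_coef0 coef_map fmorph_eq0.
Qed.

(** With d = deg p and c = p(0)^-1, self-duality and additivity of the q-th power give P(x^-q) = (c
    x^-d P(x))^q. *)
Lemma SCRIM_root_conj (L : fieldType) (f : {rmorphism F -> L}) p (x : L) :
  SCRIM q p -> root (map_poly f p) x ->
  root (map_poly f p) (x ^- q).
Proof.
move=> [_ _ p00 p_dag] px.
have L_pchar : [pchar L].-nat q by rewrite (eq_pnat _ (fmorph_pchar f)).
have x0 := map_root_neq0 p00 px.
set P := map_poly f p; pose c := f (p`_0)^-1.
have P_coef i : (i < size p)%N -> P`_i = (c * P`_((size p).-1 - i)) ^+ q.
  move=> lt_i; rewrite !coef_map {1}p_dag coef_map_id0.
    by rewrite coefZ coef_poly lt_i -rmorphM -rmorphXn.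
  by rewrite /fconj expr0n gtn_eqF.
apply/rootP; rewrite horner_coef size_map_poly.
(* Term by term, x^-i = x^-d x^(d-i) pairs the reversed coefficient with its own power of x. *)
transitivity ((\sum_(i < size p) c * x ^- (size p).-1 *
    (P`_(rev_ord i) * x ^+ rev_ord i)) ^+ q).
  rewrite expr_pchar_sum //; apply: eq_bigr => i _.
  have le_i : (i <= (size p).-1)%N by case: (size p) i => [[]|n i] //; rewrite -ltnS.
  have revE : rev_ord i = ((size p).-1 - i)%N :> nat by rewrite /= subnS -subn1 subnAC subn1.
  rewrite revE (P_coef _ (ltn_ord i)) -exprVn -exprM mulnC exprM -exprMn.
  congr (_ ^+ q); rewrite mulrACA; congr (_ * _).
  by rewrite expfB_cond ?(negPf x0) // mulKf ?expf_neq0 // exprVn.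
have sum0 : \sum_(i < size p) P`_(rev_ord i) * x ^+ rev_ord i = 0.
  by rewrite -[RHS](rootP px) horner_coef size_map_poly [RHS](reindex_inj rev_ord_inj).
rewrite -big_distrr /= sum0.
by rewrite mulr0 expr0n gtn_eqF //.
Qed.

(** The root x^-q is a conjugate x^(q^(2j)) of x. If j = 0 then x^(q+1) = 1, so e = 1; otherwise
    x^(q (q^(2j-1) + 1)) = 1, and cancelling the q-th power leaves e = 2j - 1. *)
Lemma SCRIM_root_order (L : fieldExtType F) p (x : L) :
  SCRIM q p -> root (map_poly (in_alg L) p) x ->
  exists2 e, odd e & x ^+ (q ^ e).+1 = 1.
Proof.
move=> p_scrim px; have [_ irr_p p00 _] := p_scrim.
have L_pchar : [pchar L].-nat q by rewrite (eq_pnat _ (pchar_lalg L)).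
have x0 := map_root_neq0 p00 px.
have [j xqE] := irreducible_roots_Frobenius irr_p px (SCRIM_root_conj p_scrim px).
have xq0 := expf_neq0 q x0.
case: j xqE => [|j] xqE.
  by exists 1%N; rewrite // expn1 exprS -[X in X * _]expr1 -(expn0 #|F|) -xqE mulVf.
exists (2 * j).+1; first by rewrite /= mul2n odd_double.
apply: (expr_pchar_eq1 L_pchar).
have exp2E : ((2 * j).+2 = 2 * j.+1)%N by lia.
by rewrite -exprM mulSn exprD -expnSr exp2E expnM -cardF -xqE mulfV.
Qed.

(** * Splitting off the 2-part of a root, and the bijection *)

Lemma SCRIM_odd_part p m n r :
    SCRIM q p -> odd n -> p %| 'X^(2 ^ m * n) - 1 ->
    (2 ^ r %| q.+1)%N -> ~~ (2 ^ r.+1 %| q.+1)%N ->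
  exists2 z, z ^+ (2 ^ minn m r) = 1 & twist z^-1 p %| 'X^n - 1.
Proof.
move=> p_scrim n_odd dvd_p dvd_r ndvd_r; have [_ irr_p _ _] := p_scrim.
have [L [x px]] := irreducible_root_ext irr_p.
move: dvd_p; rewrite (root_Xn_sub1 _ irr_p px) => /eqP xn.
have x0 : x != 0 by apply: map_root_neq0 px; case: p_scrim.
have [e e_odd xe] := SCRIM_root_order p_scrim px.
have co_n : coprime (2 ^ m) n by rewrite coprimeXl // coprime2n.
(* As [a] is 1 modulo 2^m and 0 modulo n, x^a is the 2-part of x. *)
set s := minn m r; pose a := chinese (2 ^ m) n 1 0.
have y_s : (x ^+ a) ^+ (2 ^ s) = 1.
  have y_m : (x ^+ a) ^+ (2 ^ m) = 1.
    have /dvdnP[k ->] : (n %| a)%N by rewrite /dvdn chinese_modr // mod0n.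
    by rewrite -exprM -mulnA [(n * _)%N]mulnC mulnC exprM xn expr1n.
  have y_e : (x ^+ a) ^+ (q ^ e).+1 = 1 by rewrite exprAC xe expr1n.
  have /dvdnP[k ->] := dvdn_gcdn_expn2 m e_odd ndvd_r.
  by rewrite mulnC exprM expr_gcdn_eq1 ?expr1n // expn_gt0.
have dvd_s : (2 ^ s %| q.+1)%N.
  by apply: dvdn_trans dvd_r; rewrite dvdn_exp2l // geq_minr.
(* Since (x^a)^(q+1) = 1 and q^2 = (q - 1)(q + 1) + 1, the Frobenius of F fixes x^a, which therefore
   lies in F. *)
have /vlineP[z yE] : x ^+ a \in 1%AS.
  rewrite Fermat's_little_theorem dimv1 expn1 cardF.
  have -> : (q ^ 2 = (q.-1 * q.+1).+1)%N.
    by case: (q) q_gt0 => // k _; lia.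
  by case/dvdnP: dvd_s => k ->; rewrite exprS mulnA mulnC exprM y_s expr1n mulr1.
have z_s : z ^+ (2 ^ s) = 1.
  by apply: (fmorph_inj (in_alg L)); rewrite rmorphXn rmorph1 /= -yE.
have z0 : z != 0.
  by apply: contra_eq_neq z_s => ->; rewrite expr0n gtn_eqF ?expn_gt0 // eq_sym oner_eq0.
have zV0 : z^-1 != 0 by rewrite invr_eq0.
exists z => //.
rewrite (@root_Xn_sub1 L _ (in_alg L z^-1 * x)) ?root_map_twist //; last first.
  exact: irreducible_twist.
(* The untwisted root is x^(1-a), and a n is congruent to n modulo 2^m n, the exponent that kills
   x. *)
rewrite exprMn fmorphV exprVn /= -yE -exprM -(expr_mod (a * n) xn).
rewrite -muln_modl chinese_modl // muln_modl expr_mod // mul1n mulVf //.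
exact: expf_neq0.
Qed.

Lemma npolyp_dvd_Xn_sub1 n p : (0 < n)%N ->
  p %| 'X^n - 1 -> npolyp n.+1 p = p :> {poly F}.
Proof.
move=> n_gt0 dvd_p; rewrite npolypK // -(size_XnsubC (1 : F) n_gt0).
by rewrite dvdp_leq // monic_neq0 // monicXnsubC.
Qed.

Lemma SCRIM_twist_dvd p z m n :
  SCRIM q p -> p %| 'X^n - 1 -> z != 0 -> z ^+ (2 ^ m) = 1 ->
  twist z p %| 'X^(2 ^ m * n) - 1.
Proof.
move=> [_ irr_p _ _] dvd_p z0 zm; have [L [x px]] := irreducible_root_ext irr_p.
rewrite (@root_Xn_sub1 L _ (in_alg L z * x)) ?root_map_twist //; last first.
  exact: irreducible_twist.
move: dvd_p; rewrite (root_Xn_sub1 _ irr_p px) => /eqP xn.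
have xmn : x ^+ (2 ^ m * n) = 1 by rewrite mulnC exprM xn expr1n.
by rewrite exprMn xmn mulr1 exprM -rmorphXn zm rmorph1 expr1n.
Qed.

(** If x is a root of p, then (z / z') x is a root of p'. Both are n-th roots of unity, so z / z'
    has order dividing n and 2^k, which are coprime. *)
Lemma twist_inj_odd n k p p' z z' :
    odd n -> irreducible_poly p -> irreducible_poly p' ->
    p %| 'X^n - 1 -> p' %| 'X^n - 1 -> z != 0 -> z' != 0 ->
    z ^+ (2 ^ k) = 1 -> z' ^+ (2 ^ k) = 1 ->
  twist z p = twist z' p' -> z = z' /\ p = p'.
Proof.
move=> n_odd irr_p irr_p' dvd_p dvd_p' z0 z'0 zk z'k tw_eq.
suffices zz' : z = z' by split=> //; apply: (can_inj (twistK z0)); rewrite tw_eq zz'.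
have [L [x px]] := irreducible_root_ext irr_p.
have p'w : root (map_poly (in_alg L) p') (in_alg L (z / z') * x).
  rewrite -(root_map_twist _ _ _ z'0) -tw_eq mulrA -rmorphM mulrCA mulfV // mulr1.
  by rewrite root_map_twist.
move: dvd_p dvd_p'; rewrite (root_Xn_sub1 _ irr_p px) (root_Xn_sub1 _ irr_p' p'w).
move=> /eqP xn; rewrite exprMn xn mulr1 -rmorphXn fmorph_eq1 => /eqP zz'n.
have zz'k : (z / z') ^+ (2 ^ k) = 1 by rewrite exprMn exprVn zk z'k divr1.
apply: (divIf z'0); rewrite divff //.
have := expr_gcdn_eq1 (odd_gt0 n_odd) zz'n zz'k.
have /eqP-> : coprime n (2 ^ k) by rewrite coprimeXr // coprimen2.
by rewrite expr1.
Qed.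

Lemma Omega_card_2part m n r : odd n ->
    (2 ^ r %| q.+1)%N -> ~~ (2 ^ r.+1 %| q.+1)%N ->
  Omega_card F q (2 ^ m * n) = (2 ^ minn m r * Omega_card F q n)%N.
Proof.
move=> n_odd dvd_r ndvd_r; have n_gt0 := odd_gt0 n_odd.
have N_gt0 : (0 < 2 ^ m * n)%N by rewrite muln_gt0 expn_gt0.
set s := minn m r; pose G := [set z : F | z ^+ (2 ^ s) == 1].
have dvd_s : (2 ^ s %| q.+1)%N.
  by apply: dvdn_trans dvd_r; rewrite dvdn_exp2l // geq_minr.
have s_gt0 : (0 < 2 ^ s)%N by rewrite expn_gt0.
have card_G : #|G| = (2 ^ s)%N.
  (* 2^s divides q + 1, hence also |F| - 1 = (q - 1)(q + 1). *)
  apply: card_unity_roots => //; rewrite cardF.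
  have -> : (q ^ 2).-1 = (q.-1 * q.+1)%N by case: (q) q_gt0 => // k _; lia.
  exact: dvdn_mull.
have G_neq0 z : z \in G -> z != 0.
  by rewrite inE; apply: contraTneq => ->; rewrite expr0n gtn_eqF // eq_sym oner_eq0.
have G_q z : z \in G -> z ^+ q.+1 = 1.
  by rewrite inE => /eqP zs; case/dvdnP: dvd_s => k ->; rewrite mulnC exprM zs expr1n.
have G_m z : z \in G -> z ^+ (2 ^ m) = 1.
  rewrite inE => /eqP zs; have /dvdnP[k ->] : (2 ^ s %| 2 ^ m)%N.
    by rewrite dvdn_exp2l // geq_minl.
  by rewrite mulnC exprM zs expr1n.
pose B := [set p : {poly_n.+1 F} | `[< SCRIM q (val p) >] && (val p %| 'X^n - 1)].
rewrite -card_G -[Omega_card F q n]/#|B| -cardsX /Omega_card.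
pose f (u : F * {poly_n.+1 F}) := npolyp (2 ^ m * n).+1 (twist u.1 (val u.2)).
have BP (p : {poly_n.+1 F}) : p \in B -> SCRIM q (val p) /\ val p %| 'X^n - 1.
  by rewrite inE => /andP[/asboolP].
(* On this domain the twisted polynomial divides X^(2^m n) - 1, so it fits the size bound and
   [npolyp] leaves it unchanged. *)
have fE u : u \in setX G B -> f u = twist u.1 (val u.2) :> {poly F}.
  case: u => z p /setXP[/= Gz /BP[p_scrim dvd_p]].
  by apply: npolyp_dvd_Xn_sub1 => //; apply: SCRIM_twist_dvd (G_neq0 _ Gz) (G_m _ Gz).
rewrite -(@card_in_imset _ _ f) => [|[z p] [z' p'] Gu Gu' f_eq]; last first.
  have := congr1 val f_eq; rewrite /= fE // fE //=.
  case/setXP: Gu => /= Gz /BP[[_ irr_p _ _] dvd_p].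
  case/setXP: Gu' => /= Gz' /BP[[_ irr_p' _ _] dvd_p'].
  case/(twist_inj_odd n_odd irr_p irr_p' dvd_p dvd_p' (G_neq0 _ Gz)
    (G_neq0 _ Gz') (G_m _ Gz) (G_m _ Gz')).
  by move=> -> /val_inj->.
apply: eq_card => g; rewrite inE; apply/andP/imsetP => [[/asboolP g_scrim dvd_g]|[[z p] Gu ->]].
  (* Surjectivity: the preimage of g is its untwist by the 2-part [z] of a root, again SCRIM because
     z^-1 also satisfies (z^-1)^(q+1) = 1. *)
  have [z zs dvd_tw] := SCRIM_odd_part g_scrim n_odd dvd_g dvd_r ndvd_r.
  have Gz : z \in G by rewrite inE zs.
  have z0 := G_neq0 _ Gz.
  have npE : npolyp n.+1 (twist z^-1 (val g)) = twist z^-1 (val g) :> {poly F}.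
    exact: npolyp_dvd_Xn_sub1.
  have Gu : (z, npolyp n.+1 (twist z^-1 (val g))) \in setX G B.
    rewrite inE Gz inE /= npE dvd_tw andbT; apply/asboolP/SCRIM_twist => //.
    by rewrite exprVn G_q ?invr1.
  exists (z, npolyp n.+1 (twist z^-1 (val g))) => //.
  by apply: val_inj; rewrite /= fE //= npE twistVK.
have := fE _ Gu; rewrite /= => ->; case/setXP: Gu => /= Gz /BP[p_scrim dvd_p].
split; last exact: SCRIM_twist_dvd (G_neq0 _ Gz) (G_m _ Gz).
by apply/asboolP/SCRIM_twist => //; exact: G_q.
Qed.

(** * The case n = 1 *)

Lemma SCRIM_XsubC1 : SCRIM q ('X - 1%:P : {poly F}).
Proof.
split; [exact: monicXsubC | exact: irredp_XsubC | |].
  by rewrite !coefE /= sub0r oppr_eq0 oner_eq0.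
apply/polyP => i; rewrite /pdagger /pconj coef_map_id0; last first.
  by rewrite /fconj expr0n gtn_eqF.
rewrite coefZ coef_poly size_XsubC /fconj.
case: i => [|[|i]] /=; rewrite !coefE /= ?subrr ?subr0 ?sub0r.
(* Additivity of the q-th power yields (-1)^q = -1 for even q as well. *)
- by rewrite mulr1 invrN1 exprNn_pchar // expr1n.
- by rewrite mulVf ?expr1n // oppr_eq0 oner_eq0.
- by rewrite mulr0 expr0n gtn_eqF.
Qed.

Lemma Omega_card1 : Omega_card F q 1 = 1%N.
Proof.
apply/eqP/cards1P; exists (npolyp 2 ('X - 1%:P)); apply/setP => p; rewrite !inE expr1.
apply/andP/eqP => [[/asboolP[p_monic irr_p _ _] dvd_p]|->].
  apply/val_inj/eqP; rewrite /= npolypK ?size_XsubC //.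
  rewrite -eqp_monic ?monicXsubC //; apply: (irredp_XsubC 1).2 dvd_p.
  by rewrite neq_ltn irr_p.1 orbT.
rewrite /= npolypK ?size_XsubC //; split=> //.
exact/asboolP/SCRIM_XsubC1.
Qed.

End Counting.

Theorem theorem2p8 (F : finFieldType) (q : nat)
    (hq : exists p k : nat, [/\ prime p, (0 < k)%N & q = (p ^ k)%N])
    (hF : #|F| = (q ^ 2)%N)
    (n m n' r : nat) (hn : (0 < n)%N) (hcop : coprime n q)
    (hdec : n = (2 ^ m * n')%N) (hodd : odd n')
    (hr : (2 ^ r %| q.+1)%N /\ ~~ (2 ^ r.+1 %| q.+1)%N) :
  [/\ Omega_card F q n =
        (if (m <= r)%N then 2 ^ m * Omega_card F q n' else 2 ^ r * Omega_card F q n')%N,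
      Omega_card F q 1 = 1%N &
      forall m0 : nat,
        Omega_card F q (2 ^ m0) = (if (m0 <= r)%N then 2 ^ m0 else 2 ^ r)%N].
Proof.
have [p [k [p_prime k_gt0 qE]]] := hq; have [dvd_r ndvd_r] := hr.
(* As |F| = p^(2k), the characteristic of F is p, of which q is a power. *)
have q_pchar : [pchar F].-nat q.
  rewrite qE pnatX pnatE // (@card_finPcharP F p (k * 2)) //.
  by rewrite hF qE expnM.
split; [|exact: Omega_card1|].
  rewrite hdec (Omega_card_2part hF q_pchar m hodd dvd_r ndvd_r).
  by rewrite /minn; case: ltngtP => // ->.
(* A power of 2 has odd part 1, which reduces the count to n = 1. *)
move=> m0; rewrite -[X in Omega_card F q X]muln1.
rewrite (Omega_card_2part hF q_pchar m0 (isT : odd 1) dvd_r ndvd_r).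
by rewrite Omega_card1 // muln1 /minn; case: ltngtP => // ->.
Qed.
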